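(* Let $l,k,c,\gamma,q_0,h_0,D_\infty>0$ and $0<\epsilon<1$ be given, and consider the mass density $\rho>0$ as an unknown of the free boundary problem (P) described in the context. Then the solution of (P), including the unknown coefficient $\rho$, is given by, with $\alpha=\frac{k}{\rho c}$, $$T(x,t)=\frac{q_0\sqrt{\pi\alpha}}{k}\left[\operatorname{erf}\left(\frac{x}{2\sqrt{\alpha t}}\right)-\operatorname{erf}(\xi)\right]\quad (0<x<s(t),\ t>0),$$ $$s(t)=2\xi\sqrt{\alpha t},\qquad r(t)=2\left[\xi+\frac{\gamma k}{2q_0\sqrt{\alpha}}\exp(\xi^2)\right]\sqrt{\alpha t}\quad (t>0),$$ with $\rho>0$ given by $$\rho=\frac{\pi}{kc}\left[\frac{q_0\operatorname{erf}(\xi)}{D_\infty\left(1-\frac{q_0}{h_0D_\infty}\right)}\right]^2$$ and $\xi>0$ the unique solution of the equation $$f_4(x)=\frac{cD_\infty}{l\sqrt\pi}\left(1-\frac{q_0}{h_0D_\infty}\right),\quad x>0,$$ where $$f_4(x)=\left[x+\frac{\gamma\sqrt\pi(1-\epsilon)}{2D_\infty\left(1-\frac{q_0}{h_0D_\infty}\right)}\operatorname{erf}(x)\exp(x^2)\right]\operatorname{erf}(x)\exp(x^2),\quad x>0,$$ if and only if $$1-\frac{q_0}{h_0D_\infty}>0.$$ (That is: there exist $\rho>0$ and $\xi>0$ such that the triple $(T,s,r)$ with $T(x,t)=\frac{q_0\sqrt{\pi\alpha}}{k}\left[\operatorname{erf}\left(\frac{x}{2\sqrt{\alpha t}}\right)-\operatorname{erf}(\xi)\right]$,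 $s(t)=2\xi\sqrt{\alpha t}$ and $r(t)=2\left[\xi+\frac{\gamma k}{2q_0\sqrt{\alpha}}\exp(\xi^2)\right]\sqrt{\alpha t}$ solves (P) if and only if this inequality holds, and in that case the equation $f_4(x)=\frac{cD_\infty}{l\sqrt\pi}\left(1-\frac{q_0}{h_0D_\infty}\right)$ has a unique positive solution, $\xi$ is this solution, and $\rho=\frac{\pi}{kc}\left[\frac{q_0\operatorname{erf}(\xi)}{D_\infty\left(1-\frac{q_0}{h_0D_\infty}\right)}\right]^2$.)
   Context: Problem (P): find $T=T(x,t)$ and free boundaries $x=s(t)$, $x=r(t)$ such that $$\rho c\,T_t(x,t)-kT_{xx}(x,t)=0,\quad 0<x<s(t),\ t>0;$$ $$T(s(t),t)=0,\quad t>0;$$ $$kT_x(s(t),t)=\rho l\,[\epsilon\dot s(t)+(1-\epsilon)\dot r(t)],\quad t>0;$$ $$T_x(s(t),t)\,(r(t)-s(t))=\gamma,\quad t>0;$$ $$r(0)=s(0)=0;$$ $$kT_x(0,t)=\frac{q_0}{\sqrt t},\quad t>0;$$ $$kT_x(0,t)=\frac{h_0}{\sqrt t}\,(T(0,t)+D_\infty),\quad t>0.$$ All parameters $l,k,\rho,c,\gamma,q_0,h_0,D_\infty$ are positive real constants and $0<\epsilon<1$. Here $T$ and $T_x$ at $x=0$ and $x=s(t)$ are the boundary values from $0<x<s(t)$. The error function is $\operatorname{erf}(x)=\frac{2}{\sqrt\pi}\int_0^x e^{-u^2}\,du$. *)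

(* Defs.v *)
From Stdlib Require Import Reals.
From Coquelicot Require Import Coquelicot.
Open Scope R_scope.

Definition erf (x : R) : R :=
  2 / sqrt PI * RInt (fun u => exp (- u ^ 2)) 0 x.

(* Classical solutions of (P).  [T] is a total function, but only its values on
   the open region 0 < x < s t, t > 0 matter: at x = 0 and x = s t the
   conditions bear on the limits T0, Tx0, Txs of T and T_x taken from inside
   that region. *)
Record is_solution_P (rho l k c gamma q0 h0 Dinf eps : R)
    (T : R -> R -> R) (s r : R -> R) : Prop := {
  domain_nonempty : forall t, 0 < t -> 0 < s t;
  temperature_regular : forall x t, 0 < t -> 0 < x < s t ->
    ex_derive (fun u => T x u) t /\
    ex_derive (fun y => T y t) x /\
    ex_derive_n (fun y => T y t) 2 x;
  free_boundaries_regular : forall t, 0 < t -> ex_derive s t /\ ex_derive r t;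
  heat_equation : forall x t, 0 < t -> 0 < x < s t ->
    rho * c * Derive (fun u => T x u) t
      - k * Derive_n (fun y => T y t) 2 x = 0;
  conditions_at_s : forall t, 0 < t -> exists Txs : R,
    filterlim (fun x => T x t) (at_left (s t)) (locally 0) /\
    filterlim (Derive (fun y => T y t)) (at_left (s t)) (locally Txs) /\
    k * Txs = rho * l * (eps * Derive s t + (1 - eps) * Derive r t) /\
    Txs * (r t - s t) = gamma;
  initial_values : r 0 = 0 /\ s 0 = 0;
  initial_continuity :
    filterlim r (at_right 0) (locally (r 0)) /\
    filterlim s (at_right 0) (locally (s 0));
  conditions_at_0 : forall t, 0 < t -> exists T0 Tx0 : R,
    filterlim (fun x => T x t) (at_right 0) (locally T0) /\
    filterlim (Derive (fun y => T y t)) (at_right 0) (locally Tx0) /\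
    k * Tx0 = q0 / sqrt t /\
    k * Tx0 = h0 / sqrt t * (T0 + Dinf)
}.

Definition diffusivity (rho k c : R) : R := k / (rho * c).

Definition temperature (rho k c q0 xi x t : R) : R :=
  let alpha := diffusivity rho k c in
  q0 * sqrt (PI * alpha) / k * (erf (x / (2 * sqrt (alpha * t))) - erf xi).

Definition boundary_s (rho k c xi t : R) : R :=
  2 * xi * sqrt (diffusivity rho k c * t).

Definition boundary_r (rho k c gamma q0 xi t : R) : R :=
  let alpha := diffusivity rho k c in
  2 * (xi + gamma * k / (2 * q0 * sqrt alpha) * exp (xi ^ 2)) * sqrt (alpha * t).

Definition f4 (gamma q0 h0 Dinf eps x : R) : R :=
  (x + gamma * sqrt PI * (1 - eps) / (2 * Dinf * (1 - q0 / (h0 * Dinf)))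
         * erf x * exp (x ^ 2))
  * erf x * exp (x ^ 2).

(* Main.v *)
(* For any [rho] and [xi] the triple satisfies the heat equation, [T = 0] at
   [s], the flux [q0 / sqrt t] at [0] and the condition [T_x (r - s) = gamma];
   what remains are the convective condition at [0] and the Stefan condition at
   [s], in which the powers of [t] cancel.  With
   [delta = 1 - q0 / (h0 Dinf)] and [a = k / (rho c)] the former reads
   [sqrt a = k Dinf delta / (q0 sqrt PI erf xi)]: it forces [delta > 0] and
   determines [rho].  Substituting this value of [sqrt a] turns the Stefan
   condition into the equation for [f4], whose left side increases from [0] to
   infinity, so that it has exactly one positive root. *)

Require Import Defs.
From Stdlib Require Import Reals Lra.
From Coquelicot Require Import Coquelicot.
Open Scope R_scope.

(** * The error function: derivative and monotonicity *)

Lemma sqrt_PI_gt_0 : 0 < sqrt PI.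
Proof. apply sqrt_lt_R0, PI_RGT_0. Qed.

Lemma is_derive_erf (x : R) : is_derive erf x (2 / sqrt PI * exp (- x ^ 2)).
Proof.
  assert (Hcont : forall z, continuous (fun u => exp (- u ^ 2)) z).
  { intros z. apply (ex_derive_continuous (V := R_NormedModule)).
    auto_derive. exact I. }
  apply (is_derive_scal (fun x => RInt (fun u => exp (- u ^ 2)) 0 x)).
  apply (is_derive_RInt (fun u => exp (- u ^ 2)) _ 0); [|apply Hcont].
  apply filter_forall. intros b. apply (RInt_correct (V := R_CompleteNormedModule)).
  apply (ex_RInt_continuous (V := R_CompleteNormedModule)). intros; apply Hcont.
Qed.

Lemma erf_0 : erf 0 = 0.
Proof. unfold erf. rewrite RInt_point. unfold zero; simpl. ring. Qed.

Lemma erf_increasing (x y : R) : x < y -> erf x < erf y.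
Proof.
  intros Hxy.
  destruct (MVT_gen erf x y (fun u => 2 / sqrt PI * exp (- u ^ 2))) as [z [_ Hz]].
  - intros u _. apply is_derive_erf.
  - intros u _. apply continuity_pt_filterlim.
    apply (ex_derive_continuous (V := R_NormedModule)).
    eexists; apply is_derive_erf.
  - assert (0 < 2 / sqrt PI * exp (- z ^ 2) * (y - x)).
    { apply Rmult_lt_0_compat; [|lra]. apply Rmult_lt_0_compat; [|apply exp_pos].
      apply Rdiv_lt_0_compat; [lra|apply sqrt_PI_gt_0]. }
    lra.
Qed.

Lemma erf_pos (x : R) : 0 < x -> 0 < erf x.
Proof. intros Hx. pose proof (erf_increasing 0 x Hx) as H. now rewrite erf_0 in H. Qed.

Lemma ex_derive_erf (x : R) : ex_derive erf x.
Proof. eexists; apply is_derive_erf. Qed.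

Lemma Derive_erf (x : R) : Derive erf x = 2 / sqrt PI * exp (- x ^ 2).
Proof. apply is_derive_unique, is_derive_erf. Qed.

(** * The transcendental equation for [xi] *)

(* [f4] is [transcendental b] with [b = gamma sqrt PI (1 - eps) / (2 Dinf delta)]. *)
Definition transcendental (b x : R) : R :=
  (x + b * erf x * exp (x ^ 2)) * erf x * exp (x ^ 2).

Lemma erf_exp_pos (x : R) : 0 < x -> 0 < erf x * exp (x ^ 2).
Proof. intros. apply Rmult_lt_0_compat; [now apply erf_pos|apply exp_pos]. Qed.

Lemma erf_exp_increasing (x y : R) :
  0 <= x -> x < y -> erf x * exp (x ^ 2) < erf y * exp (y ^ 2).
Proof.
  intros Hx Hxy. apply Rmult_le_0_lt_compat.
  - destruct Hx as [Hx| <-]; [left; now apply erf_pos|rewrite erf_0; lra].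
  - left; apply exp_pos.
  - now apply erf_increasing.
  - apply exp_increasing. nra.
Qed.

(** With [u = erf x * exp (x ^ 2)] the function is [(x + b * u) * u], a product of two positive
    factors, each increasing in [x]. *)
Lemma transcendental_increasing (b x y : R) :
  0 < b -> 0 < x -> x < y -> transcendental b x < transcendental b y.
Proof.
  intros Hb Hx Hxy. unfold transcendental.
  pose proof (erf_exp_pos x Hx). pose proof (erf_exp_increasing x y ltac:(lra) Hxy).
  set (u := erf x * exp (x ^ 2)) in *. set (v := erf y * exp (y ^ 2)) in *.
  replace ((x + b * erf x * exp (x ^ 2)) * erf x * exp (x ^ 2))
    with ((x + b * u) * u) by (unfold u; ring).
  replace ((y + b * erf y * exp (y ^ 2)) * erf y * exp (y ^ 2))
    with ((y + b * v) * v) by (unfold v; ring).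
  assert (b * u < b * v) by (now apply Rmult_lt_compat_l).
  assert (0 < b * u) by (now apply Rmult_lt_0_compat).
  apply Rmult_le_0_lt_compat; lra.
Qed.

Lemma transcendental_unique_root (b m : R) : 0 < b -> 0 < m ->
  exists! x, 0 < x /\ transcendental b x = m.
Proof.
  intros Hb Hm.
  pose proof (erf_pos 1 ltac:(lra)) as He.
  (* Chosen so that [M * erf 1 = m + erf 1] exceeds [m]; since [M > 1], the term
     [M * erf M * exp (M ^ 2)] alone is already larger than that. *)
  set (M := 1 + m / erf 1).
  assert (HM : 1 < M) by (unfold M; pose proof (Rdiv_lt_0_compat m (erf 1) Hm He); lra).
  assert (Hbig : m < transcendental b M).
  { unfold transcendental.
    pose proof (erf_exp_pos M ltac:(lra)) as Hv.
    assert (Hev : erf 1 < erf M * exp (M ^ 2)).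
    { pose proof (erf_increasing 1 M HM). pose proof (exp_ineq1 (M ^ 2) ltac:(nra)). nra. }
    set (v := erf M * exp (M ^ 2)) in *.
    replace ((M + b * erf M * exp (M ^ 2)) * erf M * exp (M ^ 2))
      with (M * v + b * v * v) by (unfold v; ring).
    clearbody v.
    assert (0 < b * v * v) by (repeat apply Rmult_lt_0_compat; lra).
    assert (M * erf 1 = m + erf 1) by (unfold M; field; lra).
    nra. }
  destruct (IVT_gen (transcendental b) 0 M m) as [x [Hx Hfx]].
  - intros z. apply continuity_pt_filterlim.
    apply (ex_derive_continuous (V := R_NormedModule)).
    unfold transcendental. auto_derive.
    repeat split; apply ex_derive_erf.
  - assert (H0 : transcendental b 0 = 0)
      by (unfold transcendental; rewrite erf_0; ring).
    rewrite H0, Rmin_left, Rmax_right; lra.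
  - rewrite Rmin_left, Rmax_right in Hx by lra.
    (* The intermediate value theorem only gives [0 <= x]; the value at [0] is [0], which differs
       from [m]. *)
    assert (Hx0 : 0 < x).
    { destruct (Hx) as [[Hlt|Heq] _]; [exact Hlt|].
      subst x. unfold transcendental in Hfx. rewrite erf_0 in Hfx. lra. }
    exists x. split; [now split|].
    intros y [Hy Hfy].
    destruct (Rtotal_order x y) as [Hlt|[Heq|Hgt]]; [|exact Heq|].
    + pose proof (transcendental_increasing b x y Hb Hx0 Hlt). lra.
    + pose proof (transcendental_increasing b y x Hb Hy Hgt). lra.
Qed.

(** * Similarity solutions of the heat equation *)

Definition profile (A a E x t : R) : R := A * (erf (x / (2 * sqrt (a * t))) - E).

Definition profile_x (A a x t : R) : R :=
  A / sqrt PI * exp (- (x / (2 * sqrt (a * t))) ^ 2) / sqrt (a * t).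

Lemma is_derive_profile_x (A a E x t : R) : 0 < a -> 0 < t ->
  is_derive (fun y => profile A a E y t) x (profile_x A a x t).
Proof.
  intros Ha Ht. pose proof (sqrt_lt_R0 (a * t) ltac:(nra)). pose proof sqrt_PI_gt_0.
  unfold profile, profile_x. auto_derive.
  - apply ex_derive_erf.
  - rewrite Derive_erf. unfold Rdiv. field. lra.
Qed.

(** The similarity variable [x / (2 * sqrt (a * t))] has a [t]-derivative equal to [- x / (2 * t)]
    times its [x]-derivative, and the chain rule passes this ratio on to the profile. *)
Lemma is_derive_profile_t (A a E x t : R) : 0 < a -> 0 < t ->
  is_derive (fun u => profile A a E x u) t (- x / (2 * t) * profile_x A a x t).
Proof.
  intros Ha Ht. pose proof (sqrt_lt_R0 (a * t) ltac:(nra)). pose proof sqrt_PI_gt_0.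
  assert (Hs2 : sqrt (a * t) * sqrt (a * t) = a * t) by (apply sqrt_sqrt; nra).
  unfold profile, profile_x. auto_derive.
  - split; [apply ex_derive_erf|split; [nra|split; [lra|exact I]]].
  - rewrite Derive_erf. unfold Rdiv.
    set (e := exp _). set (w := sqrt (a * t)) in *.
    replace t with (w * w / a) by (rewrite Hs2; field; lra).
    field. lra.
Qed.

(** Differentiating the Gaussian reproduces it with the factor [- x / (2 * a * t)]. This is [1 / a]
    times the factor in the time derivative, which is the heat equation. *)
Lemma is_derive_profile_x_x (A a x t : R) : 0 < a -> 0 < t ->
  is_derive (fun y => profile_x A a y t) x (- x / (2 * a * t) * profile_x A a x t).
Proof.
  intros Ha Ht. pose proof (sqrt_lt_R0 (a * t) ltac:(nra)). pose proof sqrt_PI_gt_0.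
  assert (Hs2 : sqrt (a * t) * sqrt (a * t) = a * t) by (apply sqrt_sqrt; nra).
  unfold profile_x. auto_derive; [exact I|].
  unfold Rdiv. simpl pow. set (e := exp _). set (w := sqrt (a * t)) in *.
  replace (2 * a * t) with (2 * (w * w)) by (rewrite Hs2; ring).
  field. lra.
Qed.

Lemma Derive_profile_x (A a E t : R) : 0 < a -> 0 < t ->
  forall x, Derive (fun y => profile A a E y t) x = profile_x A a x t.
Proof. intros Ha Ht x. now apply is_derive_unique, is_derive_profile_x. Qed.

Lemma is_derive_Derive_profile (A a E x t : R) : 0 < a -> 0 < t ->
  is_derive (Derive (fun y => profile A a E y t)) x
    (- x / (2 * a * t) * profile_x A a x t).
Proof.
  intros Ha Ht. eapply is_derive_ext; [|now apply is_derive_profile_x_x].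
  intros y. simpl. symmetry. now apply Derive_profile_x.
Qed.

Lemma continuous_at_left (f : R -> R) (x : R) :
  continuous f x -> filterlim f (at_left x) (locally (f x)).
Proof. intros H. eapply filterlim_filter_le_1; [apply filter_le_within|exact H]. Qed.

Lemma continuous_at_right (f : R -> R) (x : R) :
  continuous f x -> filterlim f (at_right x) (locally (f x)).
Proof. intros H. eapply filterlim_filter_le_1; [apply filter_le_within|exact H]. Qed.

Lemma continuous_profile (A a E x t : R) : 0 < a -> 0 < t ->
  continuous (fun y => profile A a E y t) x /\
  continuous (Derive (fun y => profile A a E y t)) x.
Proof.
  intros Ha Ht. split; apply (ex_derive_continuous (V := R_NormedModule)); eexists.
  - now apply is_derive_profile_x.
  - now apply is_derive_Derive_profile.
Qed.

Lemma is_derive_const_mult_sqrt (m a t : R) : 0 < a -> 0 < t ->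
  is_derive (fun u => m * sqrt (a * u)) t (m * sqrt a / (2 * sqrt t)).
Proof.
  intros Ha Ht. pose proof (sqrt_lt_R0 a Ha). pose proof (sqrt_lt_R0 t Ht).
  auto_derive; [nra|].
  rewrite sqrt_mult by lra. set (u := sqrt a) in *.
  replace a with (u * u) by (apply sqrt_sqrt; lra).
  field. lra.
Qed.

(** At [0] the square root is not differentiable, so continuity comes from [continuous_sqrt] and
    composition rather than from a derivative. *)
Lemma const_mult_sqrt_right_continuous (m a : R) :
  filterlim (fun u => m * sqrt (a * u)) (at_right 0) (locally (m * sqrt (a * 0))).
Proof.
  apply (continuous_at_right (fun u => m * sqrt (a * u))).
  apply (continuous_scal_r (V := R_NormedModule) m (fun u => sqrt (a * u))).
  apply (continuous_comp (fun u => a * u) sqrt).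
  - apply (ex_derive_continuous (V := R_NormedModule)). auto_derive. exact I.
  - apply continuous_sqrt.
Qed.

(** * Reduction of (P) to two scalar equations *)

(** The two equations are the convective and the Stefan condition with the common factor
    [1 / sqrt t] removed. Hence evaluation at [t = 1] yields them, and they in turn give both
    conditions at every [t]. *)
Lemma is_solution_P_iff (rho l k c gamma q0 h0 Dinf eps xi : R) :
  0 < rho -> 0 < k -> 0 < c -> 0 < q0 -> 0 < xi ->
  let a := diffusivity rho k c in
  is_solution_P rho l k c gamma q0 h0 Dinf eps
    (temperature rho k c q0 xi) (boundary_s rho k c xi)
    (boundary_r rho k c gamma q0 xi)
  <->
  q0 = h0 * (Dinf - q0 * sqrt (PI * a) / k * erf xi) /\
  q0 * exp (- xi ^ 2)
    = rho * l * (xi * sqrt a + (1 - eps) * gamma * k / (2 * q0) * exp (xi ^ 2)).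
Proof.
  intros Hrho Hk Hc Hq0 Hxi a.
  assert (Ha : 0 < a) by (apply Rdiv_lt_0_compat; [|apply Rmult_lt_0_compat]; lra).
  pose proof (sqrt_lt_R0 a Ha) as Hsa. pose proof sqrt_PI_gt_0 as HPI.
  set (A := q0 * sqrt (PI * a) / k).
  set (E := erf xi).
  set (sigma := 2 * xi).
  set (mu := 2 * (xi + gamma * k / (2 * q0 * sqrt a) * exp (xi ^ 2))).
  change (temperature rho k c q0 xi) with (profile A a E).
  change (boundary_s rho k c xi) with (fun t => sigma * sqrt (a * t)).
  change (boundary_r rho k c gamma q0 xi) with (fun t => mu * sqrt (a * t)).
  assert (Hprod : forall t, 0 < t -> 0 < sqrt t /\ sqrt (a * t) = sqrt a * sqrt t).
  { intros t Ht. split; [now apply sqrt_lt_R0|apply sqrt_mult; lra]. }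
  assert (HA : A = q0 * sqrt PI * sqrt a / k).
  { unfold A. rewrite sqrt_mult by (try apply Rlt_le, PI_RGT_0; lra). unfold Rdiv; ring. }
  assert (HTs : forall t, 0 < t -> profile A a E (sigma * sqrt (a * t)) t = 0).
  { intros t Ht. destruct (Hprod t Ht) as [Hst ->]. unfold profile, sigma, E.
    replace (2 * xi * (sqrt a * sqrt t) / (2 * sqrt (a * t))) with xi.
    - ring.
    - rewrite sqrt_mult by lra. field. lra. }
  assert (HTxs : forall t, 0 < t -> profile_x A a (sigma * sqrt (a * t)) t
                   = q0 / k * exp (- xi ^ 2) / sqrt t).
  { intros t Ht. destruct (Hprod t Ht) as [Hst Hat]. unfold profile_x, sigma.
    rewrite Hat, HA.
    replace (2 * xi * (sqrt a * sqrt t) / (2 * (sqrt a * sqrt t))) with xi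
      by (field; lra).
    field. lra. }
  assert (HT0 : forall t, 0 < t -> profile A a E 0 t = - (A * E)).
  { intros t _. unfold profile. unfold Rdiv. rewrite Rmult_0_l, erf_0. ring. }
  assert (HTx0 : forall t, 0 < t -> profile_x A a 0 t = q0 / k / sqrt t).
  { intros t Ht. destruct (Hprod t Ht) as [Hst Hat]. unfold profile_x.
    replace (- (0 / (2 * sqrt (a * t))) ^ 2) with 0 by (unfold Rdiv; ring).
    rewrite exp_0, Hat, HA. field. lra. }
  assert (Hrate : forall m t, 0 < t ->
            Derive (fun u => m * sqrt (a * u)) t = m * sqrt a / (2 * sqrt t)).
  { intros m t Ht. now apply is_derive_unique, is_derive_const_mult_sqrt. }
  assert (HlimT : forall x t, 0 < t ->
            filterlim (fun y => profile A a E y t) (at_left x)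
              (locally (profile A a E x t)) /\
            filterlim (fun y => profile A a E y t) (at_right x)
              (locally (profile A a E x t)) /\
            filterlim (Derive (fun y => profile A a E y t)) (at_left x)
              (locally (profile_x A a x t)) /\
            filterlim (Derive (fun y => profile A a E y t)) (at_right x)
              (locally (profile_x A a x t))).
  { intros x t Ht. destruct (continuous_profile A a E x t Ha Ht) as [H1 H2].
    rewrite <- (Derive_profile_x A a E t Ha Ht).
    repeat split; try (now apply (continuous_at_left (fun y => profile A a E y t)));
      try (now apply (continuous_at_right (fun y => profile A a E y t)));
      try (now apply continuous_at_left); now apply continuous_at_right. }
  split.
  - intros HP. split.
    + destruct (conditions_at_0 _ _ _ _ _ _ _ _ _ _ _ _ HP 1 Rlt_0_1)
        as (T0 & Tx0 & L1 & _ & C1 & C2).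
      destruct (HlimT 0 1 Rlt_0_1) as (_ & L2 & _ & _).
      (* The record only asserts that some boundary value exists; uniqueness of limits identifies it
         with the value of the explicit profile. *)
      pose proof (filterlim_locally_unique (K := R_AbsRing) (V := R_NormedModule)
                    _ _ _ L1 L2) as Heq.
      rewrite (HT0 1 Rlt_0_1) in Heq.
      rewrite C1, Heq, sqrt_1 in C2. unfold Rdiv in C2. rewrite Rinv_1 in C2. lra.
    + destruct (conditions_at_s _ _ _ _ _ _ _ _ _ _ _ _ HP 1 Rlt_0_1)
        as (Txs & _ & L1 & C & _).
      destruct (HlimT (sigma * sqrt (a * 1)) 1 Rlt_0_1) as (_ & _ & L2 & _).
      pose proof (filterlim_locally_unique (K := R_AbsRing) (V := R_NormedModule)
                    _ _ _ L1 L2) as Heq.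
      rewrite (HTxs 1 Rlt_0_1) in Heq.
      rewrite Heq, !Hrate, sqrt_1 in C by lra.
      replace (q0 * exp (- xi ^ 2)) with (k * (q0 / k * exp (- xi ^ 2) / 1))
        by (field; lra).
      rewrite C. unfold sigma, mu. field. lra.
  - intros [B0 Bs]. constructor.
    + intros t Ht. destruct (Hprod t Ht) as [Hst ->]. unfold sigma.
      repeat apply Rmult_lt_0_compat; lra.
    + intros x t Ht _. split; [|split].
      * eexists; now apply is_derive_profile_t.
      * eexists; now apply is_derive_profile_x.
      * eexists; now apply is_derive_Derive_profile.
    + intros t Ht. split; eexists; now apply is_derive_const_mult_sqrt.
    + intros x t Ht _.
      assert (Ht1 : Derive (fun u => profile A a E x u) t
                    = - x / (2 * t) * profile_x A a x t)
        by (now apply is_derive_unique, is_derive_profile_t).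
      assert (Hx2 : Derive_n (fun y => profile A a E y t) 2 x
                    = - x / (2 * a * t) * profile_x A a x t)
        by (now apply is_derive_unique, is_derive_Derive_profile).
      rewrite Ht1, Hx2.
      (* Only the [a] in the coefficient of the second derivative is expanded; [profile_x A a x t]
         stays a common factor. *)
      unfold a at 2, diffusivity. field. lra.
    + intros t Ht. destruct (Hprod t Ht) as [Hst Hat].
      exists (profile_x A a (sigma * sqrt (a * t)) t).
      destruct (HlimT (sigma * sqrt (a * t)) t Ht) as (L1 & _ & L2 & _).
      rewrite (HTs t Ht) in L1.
      split; [exact L1|]. split; [exact L2|].
      rewrite (HTxs t Ht), !Hrate by lra. split.
      * replace (k * (q0 / k * exp (- xi ^ 2) / sqrt t))
          with (q0 * exp (- xi ^ 2) / sqrt t) by (field; lra).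
        rewrite Bs. unfold sigma, mu. field. lra.
      (* The gap [r - s] carries [exp (xi ^ 2)] and [sqrt t], which cancel the [exp (- xi ^ 2)] and
         [1 / sqrt t] of the flux, leaving [gamma]. *)
      * rewrite Hat. unfold sigma, mu. rewrite exp_Ropp.
        pose proof (exp_pos (xi ^ 2)). field. lra.
    + rewrite Rmult_0_r, sqrt_0. split; ring.
    + split; apply const_mult_sqrt_right_continuous.
    + intros t Ht. destruct (Hprod t Ht) as [Hst Hat].
      exists (profile A a E 0 t), (profile_x A a 0 t).
      destruct (HlimT 0 t Ht) as (_ & L1 & _ & L2).
      split; [exact L1|]. split; [exact L2|].
      rewrite (HT0 t Ht), (HTx0 t Ht). split; [field; lra|].
      replace (k * (q0 / k / sqrt t)) with (q0 / sqrt t) by (field; lra).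
      rewrite B0 at 1. fold A. unfold E. unfold Rdiv. ring.
Qed.

(** * Elimination of the density *)

Lemma flux_and_Stefan_iff_f4 (rho l k c gamma q0 h0 Dinf eps xi : R)
  (delta := 1 - q0 / (h0 * Dinf)) (a := diffusivity rho k c) :
  0 < l -> 0 < k -> 0 < c -> 0 < q0 -> 0 < h0 -> 0 < Dinf -> 0 < xi -> 0 < rho ->
  q0 = h0 * (Dinf - q0 * sqrt (PI * a) / k * erf xi) /\
  q0 * exp (- xi ^ 2)
    = rho * l * (xi * sqrt a + (1 - eps) * gamma * k / (2 * q0) * exp (xi ^ 2))
  <->
  0 < delta /\
  f4 gamma q0 h0 Dinf eps xi = c * Dinf / (l * sqrt PI) * delta /\
  rho = PI / (k * c) * (q0 * erf xi / (Dinf * delta)) ^ 2.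
Proof.
  intros Hl Hk Hc Hq0 Hh0 HD Hxi Hrho.
  assert (Ha : 0 < a) by (apply Rdiv_lt_0_compat; [|apply Rmult_lt_0_compat]; lra).
  pose proof (sqrt_lt_R0 a Ha) as Hsa. pose proof sqrt_PI_gt_0 as HPI.
  pose proof (erf_pos xi Hxi) as HE. pose proof (exp_pos (xi ^ 2)) as HG.
  (* Trading [rho] for [sqrt a] makes both equations rational in one unknown, and the convective one
     affine in it. *)
  assert (Hrhoa : rho = k / (c * (sqrt a * sqrt a))).
  { rewrite sqrt_sqrt by lra. unfold a, diffusivity. field. lra. }
  assert (HPP : sqrt PI * sqrt PI = PI) by (apply sqrt_sqrt, Rlt_le, PI_RGT_0).
  assert (Hdelta : h0 * (Dinf * delta) = h0 * Dinf - q0) by (unfold delta; field; lra).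
  unfold f4. fold delta. rewrite exp_Ropp.
  rewrite sqrt_mult by (try apply Rlt_le, PI_RGT_0; lra).
  set (E := erf xi) in *. set (G := exp (xi ^ 2)) in *.
  set (p := sqrt PI) in *. set (w := sqrt a) in *.
  (* From here on these are plain real unknowns, tied together only by [Hrhoa], [HPP], [Hdelta] and
     their signs, so each identity is one for [field]. *)
  clearbody delta E G p w.
  assert (HpE : 0 < q0 * p * E) by (repeat apply Rmult_lt_0_compat; lra).
  assert (Hflux : q0 = h0 * (Dinf - q0 * (p * w) / k * E) <->
                  w = k * (Dinf * delta) / (q0 * p * E)).
  { split; intros H.
    - apply (Rmult_eq_reg_l (q0 * p * E / k)); [|apply Rgt_not_eq, Rdiv_lt_0_compat; lra].
      transitivity (Dinf * delta); [|field; lra].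
      apply (Rmult_eq_reg_l h0); [|lra]. rewrite Hdelta.
      transitivity (h0 * (q0 * (p * w) / k * E)); [field; lra|lra].
    - replace (q0 * (p * w) / k * E) with (Dinf * delta); [lra|].
      rewrite H. field. lra. }
  assert (Hstefan : w = k * (Dinf * delta) / (q0 * p * E) -> 0 < delta ->
    (q0 * / G = rho * l * (xi * w + (1 - eps) * gamma * k / (2 * q0) * G) <->
     (xi + gamma * p * (1 - eps) / (2 * Dinf * delta) * E * G) * E * G
       = c * Dinf / (l * p) * delta)).
  { intros Hw Hd. rewrite Hrhoa, Hw.
    split; intros H.
    (* This factor turns the right side of the [f4] equation into [q0 * / G], the left side of the
       Stefan condition; the converse uses its inverse. *)
    - apply (Rmult_eq_reg_l (q0 * l * p / (c * Dinf * delta * G)));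
        [|apply Rgt_not_eq, Rdiv_lt_0_compat; repeat apply Rmult_lt_0_compat; lra].
      transitivity (q0 * / G); [rewrite H|]; field; lra.
    - apply (Rmult_eq_reg_l (c * Dinf * delta * G / (q0 * l * p)));
        [|apply Rgt_not_eq, Rdiv_lt_0_compat; repeat apply Rmult_lt_0_compat; lra].
      transitivity (c * Dinf / (l * p) * delta); [|rewrite <- H]; field; lra. }
  split.
  - intros [H0 Hs]. apply Hflux in H0.
    (* The positive number [w] is a positive multiple of [delta]. *)
    assert (Hd : 0 < delta).
    { apply (Rmult_lt_reg_l (k * Dinf / (q0 * p * E)));
        [apply Rdiv_lt_0_compat; [apply Rmult_lt_0_compat|]; lra|].
      replace (k * Dinf / (q0 * p * E) * delta) with w by (rewrite H0; field; lra). lra. }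
    split; [exact Hd|]. split; [now apply Hstefan|].
    rewrite Hrhoa, H0, <- HPP. field. lra.
  - intros (Hd & Hf & Hr).
    (* The formula for [rho] fixes only the square of [w]; positivity of [delta] makes both
       candidates nonnegative, hence equal. *)
    assert (Hw : w = k * (Dinf * delta) / (q0 * p * E)).
    { assert (HDd : 0 < Dinf * delta) by (now apply Rmult_lt_0_compat).
      apply Rsqr_inj; [lra|left; apply Rdiv_lt_0_compat; nra|]. unfold Rsqr.
      transitivity (k / (c * rho)); [rewrite Hrhoa; field; lra|].
      rewrite Hr, <- HPP. field. lra. }
    split; [now apply Hflux|now apply Hstefan].
Qed.

(** * Existence criterion and characterization of [rho] and [xi] *)

Theorem theorem3p5 (l k c gamma q0 h0 Dinf eps : R)
  (hl : 0 < l) (hk : 0 < k) (hc : 0 < c) (hgamma : 0 < gamma)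
  (hq0 : 0 < q0) (hh0 : 0 < h0) (hDinf : 0 < Dinf) (heps : 0 < eps < 1) :
  ((exists rho xi : R, 0 < rho /\ 0 < xi /\
      is_solution_P rho l k c gamma q0 h0 Dinf eps
        (temperature rho k c q0 xi)
        (boundary_s rho k c xi)
        (boundary_r rho k c gamma q0 xi))
   <-> 1 - q0 / (h0 * Dinf) > 0)
  /\
  (1 - q0 / (h0 * Dinf) > 0 ->
     (exists! xi : R, 0 < xi /\
        f4 gamma q0 h0 Dinf eps xi
          = c * Dinf / (l * sqrt PI) * (1 - q0 / (h0 * Dinf)))
     /\
     (forall rho xi : R,
        (0 < rho /\ 0 < xi /\
         is_solution_P rho l k c gamma q0 h0 Dinf eps
           (temperature rho k c q0 xi)
           (boundary_s rho k c xi)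
           (boundary_r rho k c gamma q0 xi))
        <->
        (0 < xi /\
         f4 gamma q0 h0 Dinf eps xi
           = c * Dinf / (l * sqrt PI) * (1 - q0 / (h0 * Dinf)) /\
         rho = PI / (k * c)
                 * (q0 * erf xi / (Dinf * (1 - q0 / (h0 * Dinf)))) ^ 2))).
Proof.
  assert (Hiff : forall rho xi : R, 0 < rho -> 0 < xi ->
    (is_solution_P rho l k c gamma q0 h0 Dinf eps
       (temperature rho k c q0 xi) (boundary_s rho k c xi)
       (boundary_r rho k c gamma q0 xi) <->
     0 < 1 - q0 / (h0 * Dinf) /\
     f4 gamma q0 h0 Dinf eps xi
       = c * Dinf / (l * sqrt PI) * (1 - q0 / (h0 * Dinf)) /\
     rho = PI / (k * c)
             * (q0 * erf xi / (Dinf * (1 - q0 / (h0 * Dinf)))) ^ 2)).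
  { intros rho xi Hrho Hxi.
    rewrite is_solution_P_iff by assumption. now apply flux_and_Stefan_iff_f4. }
  (* [Hiff] presupposes a positive density, so the density prescribed by the formula must first be
     shown positive. *)
  assert (Hrho : 0 < 1 - q0 / (h0 * Dinf) -> forall xi, 0 < xi ->
    0 < PI / (k * c) * (q0 * erf xi / (Dinf * (1 - q0 / (h0 * Dinf)))) ^ 2).
  { intros Hd xi Hxi. pose proof (erf_pos xi Hxi). pose proof PI_RGT_0.
    apply Rmult_lt_0_compat; [|apply pow_lt];
      apply Rdiv_lt_0_compat; [|apply Rmult_lt_0_compat..]; try assumption;
      now apply Rmult_lt_0_compat. }
  assert (Hroot : 0 < 1 - q0 / (h0 * Dinf) ->
    exists! xi : R, 0 < xi /\
      f4 gamma q0 h0 Dinf eps xi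
        = c * Dinf / (l * sqrt PI) * (1 - q0 / (h0 * Dinf))).
  { intros Hd. pose proof sqrt_PI_gt_0.
    (* [f4] unfolds to [transcendental b]; the two remaining goals are positivity of [b] and of the
       right-hand side. *)
    apply transcendental_unique_root.
    - apply Rdiv_lt_0_compat; repeat apply Rmult_lt_0_compat; lra.
    - apply Rmult_lt_0_compat; [|lra].
      apply Rdiv_lt_0_compat; apply Rmult_lt_0_compat; lra. }
  split.
  - split.
    + intros (rho & xi & Hr & Hx & HP). now apply (Hiff rho xi Hr Hx) in HP.
    + intros Hd. destruct (Hroot Hd) as [xi [[Hx Hf] _]].
      eexists _, xi. split; [exact (Hrho Hd xi Hx)|]. split; [exact Hx|].
      apply Hiff; [now apply Hrho|exact Hx|]. now split; [|split].
  - intros Hd. split; [now apply Hroot|]. intros rho xi. split.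
    + intros (Hr & Hx & HP). split; [exact Hx|]. now apply (Hiff rho xi Hr Hx).
    + intros (Hx & Hf & Hr). pose proof (Hrho Hd xi Hx) as Hpos. rewrite <- Hr in Hpos.
      split; [exact Hpos|]. split; [exact Hx|]. apply Hiff; [assumption..|].
      now split; [|split].
Qed.
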